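(* Let $\kappa\ge2$ and $A\ge q$ be integers and let $\mathbf{a}=(a_n)_{n\ge1}$ be a sequence in $\mathbb{F}_q[T]$ with $q\le|a_n|\le A$ for all $n\ge1$. Assume there exists an integer $n_0\ge1$ such that $p(\mathbf{a},n)\le\kappa n$ for all $n\ge n_0$, and that $\mathrm{Dio}(\mathbf{a})$ is finite. Put $\xi:=[0,a_1,a_2,\ldots]$. Then $w_2(\xi)\le 128(2\kappa+1)^3\,\mathrm{Dio}(\mathbf{a})\left(\frac{\log A}{\log q}\right)^4$. In particular, if the sequence $(|q_n|^{1/n})_{n\ge1}$ converges, then $w_2(\xi)\le 64(2\kappa+1)^3\,\mathrm{Dio}(\mathbf{a})$.
   Context: $p$ is a prime, $q$ a power of $p$; $\mathbb{F}_q((T^{-1}))$ is the Laurent series field over $\mathbb{F}_q$ with $|\sum_{n\ge N}a_nT^{-n}|=q^{-N}$ ($a_N\ne0$), extended uniquely to an algebraic closure; for $P\in(\mathbb{F}_q[T])[X]$, $H(P)$ is the maximum absolute value of its coefficients; $w_2(\xi)$ is the supremum of real $w$ such that $0<|P(\xi)|\le H(P)^{-w}$ holds for infinitely many $P\in(\mathbb{F}_q[T])[X]$ of degree at most $2$ in $X$. $[a_0,a_1,\ldots]$ denotes the continued fraction $a_0+1/(a_1+1/(a_2+\cdots))$; its convergents $p_n/q_n$ are given by $p_{-1}=1,p_0=a_0,p_n=a_np_{n-1}+p_{n-2}$, $q_{-1}=0,q_0=1,q_n=a_nq_{n-1}+q_{n-2}$. Words: for a finite alphabet, $|W|$ is the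 length of a word $W$, $W^n$ is $n$-fold concatenation, and for real $w\ge0$, $W^w=W^{\lfloor w\rfloor}W'$ with $W'$ the prefix of $W$ of length $\lceil (w-\lfloor w\rfloor)|W|\rceil$. A sequence $\mathbf{a}$ (identified with an infinite word) satisfies Condition $( * )_\rho$ if there are finite words $U_n,V_n$ and reals $w_n\ge0$ ($n\ge1$) with: $U_nV_n^{w_n}$ is a prefix of $\mathbf{a}$; $|U_nV_n^{w_n}|/|U_nV_n|\ge\rho$; and $(|V_n^{w_n}|)_{n\ge1}$ strictly increasing. The Diophantine exponent $\mathrm{Dio}(\mathbf{a})\in[1,+\infty]$ is the supremum of $\rho$ such that $\mathbf{a}$ satisfies $( * )_\rho$. The complexity function is $p(\mathbf{a},n)=\mathrm{Card}\{a_ia_{i+1}\cdots a_{i+n-1}: i\ge1\}$ (number of distinct factors of length $n$). *)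

(* Defs.v *)
From HB Require Import structures.
From mathcomp Require Import all_boot all_order all_algebra finmap.
From mathcomp Require Import all_classical all_reals all_analysis.

Set Implicit Arguments.
Unset Strict Implicit.
Unset Printing Implicit Defensive.

Import Order.TTheory GRing.Theory Num.Theory.
Import numFieldNormedType.Exports.

Local Open Scope classical_set_scope.
Local Open Scope ring_scope.

(* F((T^-1)): [lcoef x n] is the coefficient of T^-n, so that the support of  *)
(* [lcoef x] is bounded below.                                                *)
Record laurent (F : fieldType) := Laurent {
  lcoef :> int -> F;
  lcoefP : exists N : int, forall n, n < N -> lcoef n = 0
}.

HB.instance Definition _ (F : fieldType) := gen_eqMixin (laurent F).
HB.instance Definition _ (F : fieldType) := gen_choiceMixin (laurent F).

Section LaurentField.
Variable F : fieldType.
Implicit Types x y z : laurent F.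

Lemma laurent_ext x y : (forall n, x n = y n) -> x = y.
Proof.
case: x y => [f fP] [g gP] /= /funext fg; rewrite -fg in gP *.
by congr Laurent; exact: Prop_irrelevance.
Qed.

Lemma lmonomP (c : F) (m : int) :
  exists N : int, forall n, n < N -> (if n == m then c else 0) = 0.
Proof. by exists m => n; rewrite lt_neqAle => /andP[/negbTE->]. Qed.
(* c T^-m *)
Definition lmonom c m := Laurent (lmonomP c m).

Lemma lzeroP : exists N : int, forall n, n < N -> 0 = 0 :> F.
Proof. by exists 0. Qed.
Definition lzero := Laurent lzeroP.

Lemma loppP x : exists N : int, forall n, n < N -> - x n = 0.
Proof. by case: (lcoefP x) => N xN; exists N => n /xN ->; rewrite oppr0. Qed.
Definition lopp x := Laurent (loppP x).

Lemma laddP x y : exists N : int, forall n, n < N -> x n + y n = 0.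
Proof.
case: (lcoefP x) (lcoefP y) => [N xN] [M yM]; exists (Order.min N M) => n.
by rewrite lt_min => /andP[/xN-> /yM->]; rewrite addr0.
Qed.
Definition ladd x y := Laurent (laddP x y).

Lemma lmulP x y :
  exists N : int, forall n, n < N -> \sum_(i \in [set: int]) x i * y (n - i) = 0.
Proof.
case: (lcoefP x) (lcoefP y) => [N xN] [M yM]; exists (N + M) => n nNM.
apply: fsbig1 => i _; case: (ltP i N) => [/xN->|Ni]; first by rewrite mul0r.
by rewrite yM ?mulr0// ltrBlDl (lt_le_trans nNM)// lerD2r.
Qed.
(* Only finitely many terms of the convolution sum are nonzero. *)
Definition lmul x y := Laurent (lmulP x y).

Definition lone := lmonom 1 0.

Fact laddA : associative ladd.
Proof. by move=> x y z; apply: laurent_ext => n /=; rewrite addrA. Qed.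
Fact laddC : commutative ladd.
Proof. by move=> x y; apply: laurent_ext => n /=; rewrite addrC. Qed.
Fact ladd0 : left_id lzero ladd.
Proof. by move=> x; apply: laurent_ext => n /=; rewrite add0r. Qed.
Fact laddN : left_inverse lzero lopp ladd.
Proof. by move=> x; apply: laurent_ext => n /=; rewrite addNr. Qed.

HB.instance Definition _ :=
  GRing.isZmodule.Build (laurent F) laddA laddC ladd0 laddN.

(* x = T^-N (X + O(T^-(K+1))) with X read as a polynomial in T^-1 *)
Let repr (N : int) (K : nat) x (X : {poly F}) :=
  (forall n, n < N -> x n = 0) /\ forall k, (k <= K)%N -> x (N + k%:Z) = X`_k.

Let lmulE N M x y (k : nat) :
    (forall n, n < N -> x n = 0) -> (forall n, n < M -> y n = 0) ->
  lmul x y (N + M + k%:Z) =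
    \sum_(i < k.+1) x (N + i%:Z) * y (M + (k - i)%N%:Z).
Proof.
move=> xN yM /=; rewrite (fsbigE [seq N + i%:Z | i <- iota 0 k.+1]); first last.
- move=> i _ iN; case: (ltP i N) => [/xN->|Ni]; first by rewrite mul0r.
  rewrite yM ?mulr0//; case: (ltP (N + k%:Z) i) => [kiN|iNk].
    by rewrite ltrBlDl addrAC ltrD2r.
  case/negP: iN; apply/mapP; exists `|i - N|%N.
    by rewrite mem_iota/= add0n ltnS -lez_nat gez0_abs ?subr_ge0// lerBlDl.
  by rewrite gez0_abs ?subr_ge0// subrKC.
- by [].
- by rewrite map_inj_uniq ?iota_uniq// => i j /addrI [].
rewrite big_map [LHS](eq_bigl xpredT); last by move=> i; rewrite in_setT.
rewrite -[iota 0 k.+1]/(index_iota 0 k.+1) big_mkord; apply: eq_bigr => i _.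
congr (_ * y _); rewrite -subzn ?leq_ord// opprD addrACA.
by rewrite [N + M]addrC addrK addrA.
Qed.

Let repr_mul N M K x y X Y :
  repr N K x X -> repr M K y Y -> repr (N + M) K (lmul x y) (X * Y).
Proof.
move=> [xN xX] [yM yY]; split=> [n nNM|k kK].
  apply: fsbig1 => i _; case: (ltP i N) => [/xN->|Ni]; first by rewrite mul0r.
  by rewrite yM ?mulr0// ltrBlDl (lt_le_trans nNM)// lerD2r.
rewrite lmulE// coefM; apply: eq_bigr => i _.
by rewrite xX ?yY// (leq_trans _ kK)// ?leq_subr// leq_ord.
Qed.

Let repr_add N K x y X Y :
  repr N K x X -> repr N K y Y -> repr N K (ladd x y) (X + Y).
Proof.
move=> [xN xX] [yM yY]; split=> [n nN|k kK] /=; first by rewrite xN// yM// addr0.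
by rewrite coefD xX// yY.
Qed.

Let repr_ex x : exists N, forall M K, M <= N -> exists X, repr M K x X.
Proof.
case: (lcoefP x) => N xN; exists N => M K MN.
exists (\poly_(k < K.+1) x (M + k%:Z)); split=> [n nM|k kK].
  by apply: xN; apply: lt_le_trans nM MN.
by rewrite coef_poly ltnS kK.
Qed.

Let repr_eq x y : (exists N, forall K, exists2 X, repr N K x X & repr N K y X) ->
  x = y.
Proof.
case=> N h; apply: laurent_ext => n; case: (h `|n - N|%N) => X [xN xX] [yN yX].
case: (ltP n N) => Nn; first by rewrite xN// yN.
by rewrite -(subrKC N n) -[n - N]gez0_abs ?subr_ge0// xX// yX.
Qed.

Fact lmulA : associative lmul.
Proof.
move=> x y z; case: (repr_ex x) (repr_ex y) (repr_ex z) => [N xN] [M yM] [L zL].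
apply: repr_eq; exists (N + (M + L)) => K.
case: (xN N K) (yM M K) (zL L K) => [//|X hX] [//|Y hY] [//|Z hZ].
exists (X * (Y * Z)); first by do 2?apply: repr_mul.
by rewrite mulrA addrA; do 2?apply: repr_mul.
Qed.

Fact lmulC : commutative lmul.
Proof.
move=> x y; case: (repr_ex x) (repr_ex y) => [N xN] [M yM].
apply: repr_eq; exists (N + M) => K; case: (xN N K) (yM M K) => [//|X hX] [//|Y hY].
by exists (X * Y); [|rewrite mulrC addrC]; apply: repr_mul.
Qed.

Fact lmulDl : left_distributive lmul ladd.
Proof.
move=> x y z; case: (repr_ex x) (repr_ex y) (repr_ex z) => [N xN] [M yM] [L zL].
apply: repr_eq; exists (Order.min N M + L) => K.
have [|X hX] := xN (Order.min N M) K; first by rewrite ge_min lexx.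
have [|Y hY] := yM (Order.min N M) K; first by rewrite ge_min lexx orbT.
have [//|Z hZ] := zL L K.
exists ((X + Y) * Z); first by apply: repr_mul => //; apply: repr_add.
by rewrite mulrDl; apply: repr_add; apply: repr_mul.
Qed.

Lemma lmonomE c m x n : lmul (lmonom c m) x n = c * x (n - m).
Proof.
rewrite /= (fsbigE [:: m]) //=; last first.
  by move=> i _; rewrite inE => /negbTE ->; rewrite mul0r.
by rewrite big_cons big_nil in_setT eqxx addr0.
Qed.

Fact lmul1 : left_id lone lmul.
Proof.
by move=> x; apply: laurent_ext => n; rewrite /lone lmonomE mul1r subr0.
Qed.

Fact lone_neq0 : lone != lzero.
Proof.
by apply/eqP => /(congr1 (fun x : laurent F => x 0)) /= /eqP; rewrite oner_eq0.
Qed.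

HB.instance Definition _ := GRing.Zmodule_isComNzRing.Build (laurent F)
  lmulA lmulC lmul1 lmulDl lone_neq0.

(* the order of a nonzero x: the least exponent of T^-1 occurring in x *)
Lemma lord_ex x : x != 0 -> exists N, x N != 0 /\ forall n, n < N -> x n = 0.
Proof.
move=> x0; have [m xm] : exists m, x m != 0.
  apply: contrapT => h; move/eqP: x0; apply; apply: laurent_ext => n /=.
  by apply/eqP/negP => /negP nx; apply: h; exists n.
case: (lcoefP x) => M xM.
have Mm : M <= m by case: (leP M m) => // /xM; move/eqP: xm.
have ex : exists k, x (M + k%:Z) != 0.
  by exists `|m - M|%N; rewrite gez0_abs ?subr_ge0// subrKC.
case: (ex_minnP ex) => k xk kmin; exists (M + k%:Z); split => // n nk.
case: (ltP n M) => [/xM//|Mn]; apply/eqP/negP => /negP xn.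
have := kmin `|n - M|%N; rewrite gez0_abs ?subr_ge0// subrKC => /(_ xn).
by rewrite -lez_nat gez0_abs ?subr_ge0// lerBrDl leNgt nk.
Qed.

Let invp (x : laurent F) (N : int) := fix U n : {poly F} := if n is m.+1 then
  U m + (((m == 0%N)%:R - ((\poly_(k < m.+1) x (N + k%:Z)) * U m)`_m) / x N) *: 'X^m
  else 0.

Let lV_ex x : x != 0 -> exists y, y * x = 1.
Proof.
move=> /lord_ex[N [xN0 xN]]; pose U := invp x N.
pose b m := ((m == 0%N)%:R - ((\poly_(k < m.+1) x (N + k%:Z)) * U m)`_m) / x N.
have UE m : U m.+1 = U m + b m *: 'X^m by [].
have U0 : U 0%N = 0 by [].
clearbody U.
have US n m : (m < n)%N -> (U n)`_m = (U m.+1)`_m.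
  elim: n m => // n IH m; rewrite ltnS leq_eqVlt => /predU1P[-> //|mn].
  by rewrite [in LHS]UE coefD coefZ coefXn ltn_eqF// mulr0 addr0 IH.
have Usz n m : (n <= m)%N -> (U n)`_m = 0.
  elim: n m => [|n IH] m nm; first by rewrite U0 coef0.
  by rewrite UE coefD IH 1?ltnW// coefZ coefXn gtn_eqF// mulr0 addr0.
have yP : exists M : int, forall n, n < M ->
    (if n < - N then 0 else (U `|n + N|.+1)`_`|n + N|) = 0.
  by exists (- N) => n ->.
exists (Laurent yP).
have yV n : n < - N -> Laurent yP n = 0 by move=> /= ->.
apply: laurent_ext => n; case: (ltP n 0) => [n0|]; last first.
  case: n => // n _.
  have -> : (Laurent yP * x) n =
      \sum_(i < n.+1) x (N + i%:Z) * (U (n - i).+1)`_(n - i).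
    have {1}-> : Posz n = N - N + n%:Z by rewrite subrr add0r.
    rewrite mulrC [LHS]lmulE//; apply: eq_bigr => i _.
    by rewrite /= ltNge lerDl /= addrAC addNr add0r absz_nat.
  transitivity (((\poly_(k < n.+1) x (N + k%:Z)) * U n.+1)`_n).
    rewrite coefM; apply: eq_bigr => i _; rewrite coef_poly ltn_ord.
    by rewrite [in RHS]US// ltnS leq_subr.
  rewrite UE mulrDr coefD -scalerAr coefZ coefMXn ltnn subnn coef_poly /=.
  by rewrite addr0 /b divfK// subrKC; case: n.
rewrite ltNge in n0; rewrite [RHS]ifN; last by apply: contraNneq n0 => ->.
have := repr_mul (N := - N) (M := N) (K := 0%N) (x := Laurent yP) (y := x)
  (X := (Laurent yP (- N))%:P) (Y := (x N)%:P).
case => //.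
- by split => // k; rewrite leqn0 => /eqP ->; rewrite coefC addr0.
- by split => // k; rewrite leqn0 => /eqP ->; rewrite coefC addr0.
by move=> h _; apply: h; rewrite addNr ltNge.
Qed.

Definition linv x : laurent F := xget 0 [set y | y * x = 1].

Fact lmulV x : x != 0 -> linv x * x = 1.
Proof. by move=> /lV_ex /(xgetPex 0). Qed.

Fact linv0 : linv 0 = 0.
Proof.
by apply: xgetPN => y /=; rewrite mulr0 => /esym/eqP; rewrite oner_eq0.
Qed.

HB.instance Definition _ :=
  GRing.ComNzRing_isField.Build (laurent F) lmulV linv0.

(* The embedding of F[T] into F((T^-1)): T^i has exponent -i in T^-1. *)
Lemma poly_laurentP (p : {poly F}) : exists N : int, forall n : int, n < N ->
  (if n <= 0 then p`_`|n| else 0) = 0.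
Proof.
exists (- (size p)%:Z) => n np; case: ifP => // n0; apply: nth_default.
by rewrite -lez_nat lez0_abs// lerNr ltW.
Qed.
Definition poly_laurent p := Laurent (poly_laurentP p).

Fact poly_laurentB : additive poly_laurent.
Proof.
move=> p q; apply: laurent_ext => n /=; rewrite coefB.
by case: ifP; rewrite ?subr0.
Qed.
HB.instance Definition _ :=
  GRing.isAdditive.Build {poly F} (laurent F) poly_laurent poly_laurentB.

Fact poly_laurentM : monoid_morphism poly_laurent.
Proof.
have mulC c p : poly_laurent (c%:P * p) = lmonom c 0 * poly_laurent p.
  apply: laurent_ext => n; rewrite lmonomE /= subr0 coefCM.
  by case: ifP; rewrite ?mulr0.
have mulX p : poly_laurent ('X * p) = lmonom 1 (- 1) * poly_laurent p.
  apply: laurent_ext => n; rewrite lmonomE /= mul1r coefXM opprK.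
  case: n => [[|n]|n] //=.
  have -> : Negz n + 1 = - n%:Z by rewrite NegzE -addn1 PoszD opprD subrK.
  by rewrite oppr_le0 abszN.
split=> [|p q].
  rewrite -[1]mulr1 -[in LHS]polyC1 mulC; apply: laurent_ext => n.
  rewrite lmonomE /= subr0 mul1r coef1.
  by case: n => [[|n]|n].
elim/poly_ind: p q => [|p c IH] q; first by rewrite mul0r raddf0 mul0r.
rewrite mulrDl !raddfD /= mulrDl -mulrA [LHS]addrC IH [in RHS]addrC.
rewrite mulC mulX -[c%:P in RHS]mulr1 mulC [p * 'X]mulrC mulX.
suff -> : poly_laurent 1 = 1 by rewrite mulr1 mulrCA mulrA.
apply: laurent_ext => n /=; rewrite coef1.
by case: n => [[|n]|n].
Qed.
HB.instance Definition _ :=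
  GRing.isMonoidMorphism.Build {poly F} (laurent F) poly_laurent poly_laurentM.

End LaurentField.

Definition lord (F : fieldType) (x : laurent F) : int :=
  xget 0 [set N : int | x N != 0 /\ forall n, n < N -> x n = 0].

Section Approximation.
Variables (R : realType) (F : finFieldType).
Implicit Types (x : laurent F) (P : {poly {poly F}}) (a : nat -> {poly F}).

Definition labs x : R := if x == 0 then 0 else #|F|%:R ^ (- lord x).

(* P is a polynomial in X with coefficients in F[T]. *)
Definition height P : R := \big[Num.max/0]_(i < size P) labs (poly_laurent P`_i).

Definition peval P x : laurent F := (map_poly (@poly_laurent F) P).[x].

(* The exponent w_d; the degree in X is at most d when [size P <= d.+1]. *)
Definition approx_exp (d : nat) x : \bar R := ereal_sup
  [set w%:E | w in [set w : R | infinite_set [set P : {poly {poly F}} |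
     (size P <= d.+1)%N /\ 0 < labs (peval P x) <= height P `^ (- w)]]].

(* Numerators p_n and denominators q_n of the convergents of [a 0, a 1, ...], *)
(* with the values p_{-1} = 1 and q_{-1} = 0 substituted in the case n = 1.   *)
Fixpoint cf_num a (n : nat) : {poly F} :=
  match n with
  | 0 => a 0%N
  | m.+1 => match m with
            | 0 => a n * cf_num a m + 1
            | k.+1 => a n * cf_num a m + cf_num a k
            end
  end.

Fixpoint cf_den a (n : nat) : {poly F} :=
  match n with
  | 0 => 1
  | m.+1 => match m with
            | 0 => a n * cf_den a m + 0
            | k.+1 => a n * cf_den a m + cf_den a k
            end
  end.

Definition convergent a n : laurent F :=
  poly_laurent (cf_num a n) / poly_laurent (cf_den a n).

(* The limit of the convergents in F((T^-1)) (0 if they do not converge). *)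
Definition cf_value a : laurent F :=
  xget 0 [set x | labs (convergent a n - x) @[n --> \oo] --> (0 : R)].

End Approximation.

(* The infinite word a 1, a 2, a 3, ... is given by a function on nat whose   *)
(* value at 0 is irrelevant.                                                  *)
Section Words.
Variables (R : realType) (T : choiceType).
Implicit Types (W : seq T) (a : nat -> T).

Definition factor a (i n : nat) : seq T := [seq a j | j <- iota i n].

Definition is_prefix W a : Prop := W = factor a 1 (size W).

Definition wpow W (w : R) : seq T :=
  flatten (nseq `|Num.floor w|%N W) ++
  take `|Num.ceil ((w - (Num.floor w)%:~R) * (size W)%:R)|%N W.

Definition star_condition a (rho : R) : Prop :=
  exists (U V : nat -> seq T) (w : nat -> R), forall n, (1 <= n)%N ->
  [/\ 0 <= w n,
      is_prefix (U n ++ wpow (V n) (w n)) a,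
      rho <= (size (U n ++ wpow (V n) (w n)))%:R / (size (U n ++ V n))%:R &
      (size (wpow (V n) (w n)) < size (wpow (V n.+1) (w n.+1)))%N].

Definition Dio a : \bar R :=
  ereal_sup [set rho%:E | rho in [set rho : R | star_condition a rho]].

(* [fset_set] sends infinite sets to the empty one, so this is meant for      *)
(* words over a finite alphabet, whose sets of factors are finite.            *)
Definition complexity a (n : nat) : nat :=
  #|` fset_set [set factor a i n | i in [set i : nat | (1 <= i)%N]]|%fset.

End Words.

(* Main.v *)
Require Import Defs.
From mathcomp Require Import all_boot all_order all_algebra finmap.
From mathcomp Require Import all_classical all_reals all_analysis.
From mathcomp Require Import zify ring lra.
Import Order.TTheory GRing.Theory Num.Theory.
Import numFieldNormedType.Exports.
Local Open Scope classical_set_scope.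
Local Open Scope ring_scope.

(* Sizes are measured by orders in 1/T; d_n is the degree of q_n, and         *)
(* th_n = q_n xi - p_n has order exactly d_(n+1).  Low complexity yields, for *)
(* every large n, two equal factors of length n starting at r < r + s of size *)
(* O(kappa n).  The corresponding eventually periodic continued fraction is a *)
(* root of a quadratic polynomial Q with Q(xi) = th_(r-1) th_(r+s) -          *)
(* th_r th_(r+s-1).  The recurrence of th shows that this determinant changes *)
(* only by a sign along the common factor, so the order of Q(xi) is known     *)
(* exactly in terms of the length m of the maximal common factor: it exceeds  *)
(* the log-height of Q by at least (d_(r+m) - d_r) + (d_(r+s+m) - d_(r+s)),   *)
(* while Dio bounds r + s + m by a multiple of r + s, hence of kappa n.       *)
(*                                                                            *)
(* Given P of degree at most 2 and log-height h, choose n proportional to h.  *)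
(* Eliminating X^2 between P and Q leaves a linear form in xi, which cannot   *)
(* be small because the partial quotients are bounded.  Hence P(xi) is not    *)
(* much smaller than Q(xi), and its order is O(kappa Dio h); the constant     *)
(* involves only the ratio of the upper and lower growth rates of d_n, which  *)
(* is log A / log q in general and arbitrarily close to 1 if d_n / n          *)
(* converges.                                                                 *)

(** The steps of this argument are carried by [has_ord_cf_err] (exact order of th_n),
    [linear_form_order] (linear forms in xi), [quad_order] (elimination), [quad_order_repetition]
    (order of Q(xi)), [complexity_repetition] and [Dio_gap] (repetitions), [quad_order_le] (choice
    of n) and [approx_exp2_le] (from orders to w_2).

    If d grows by at least c1 n over n steps and d_n is at most c2 n, [approx_exp_complexity] gives
    w_2(xi) <= 48 (c2/c1) kappa D, where D is the Diophantine exponent. This is linear in kappa and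
    stronger than the stated bounds: c2/c1 is log A / log q >= 1 in general, and can be taken to be
    4 when |q_n|^(1/n) converges. *)

(* [factor] is also the name of a constant of MathComp-Analysis. *)
Local Notation factor := Defs.factor.

(** * Orders in F((1/T)) *)

Section Degree.
Local Set Implicit Arguments.
Local Unset Strict Implicit.
Variable F : fieldType.
Implicit Types p q : {poly F}.

(** The zero polynomial gets degree 0, so a bound on [pdeg] never excludes it, while positive [pdeg]
    implies nonzero. *)
Definition pdeg p := (size p).-1.

Lemma pdeg_gt0_neq0 p : (0 < pdeg p)%N -> p != 0.
Proof. by apply: contraTneq => ->; rewrite /pdeg size_poly0. Qed.

Lemma pdeg1 : pdeg 1 = 0%N.
Proof. by rewrite /pdeg size_poly1. Qed.

Lemma pdegN p : pdeg (- p) = pdeg p.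
Proof. by rewrite /pdeg size_polyN. Qed.

Lemma pdegM p q : p != 0 -> q != 0 -> pdeg (p * q) = (pdeg p + pdeg q)%N.
Proof.
move=> p0 q0; rewrite /pdeg size_mul//.
move: p0 q0; rewrite -!size_poly_gt0.
by case: (size p) (size q) => [|k] [|l] //= _ _; rewrite addnS.
Qed.

Lemma leq_pdegM p q : (pdeg (p * q) <= pdeg p + pdeg q)%N.
Proof.
have [->|p0] := eqVneq p 0; first by rewrite mul0r /pdeg size_poly0.
have [->|q0] := eqVneq q 0; first by rewrite mulr0 /pdeg size_poly0.
by rewrite pdegM.
Qed.

Lemma leq_pdegD p q n : (pdeg p <= n)%N -> (pdeg q <= n)%N -> (pdeg (p + q) <= n)%N.
Proof.
move=> pn qn; have := size_polyD p q; rewrite leq_max /pdeg => /orP[] pq.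
  by apply: leq_trans pn; rewrite /pdeg -!subn1 leq_sub2r.
by apply: leq_trans qn; rewrite /pdeg -!subn1 leq_sub2r.
Qed.

Lemma pdegD p q : (pdeg q < pdeg p)%N -> pdeg (p + q) = pdeg p.
Proof.
rewrite /pdeg => qp; rewrite size_polyDl//; move: qp.
by case: (size p) (size q) => [|k] [|l].
Qed.

End Degree.

Section LaurentOrder.
Local Set Implicit Arguments.
Local Unset Strict Implicit.
Variable F : fieldType.
Implicit Types (x y : laurent F) (p q : {poly F}) (k l : int).

(** Orders are relations rather than values because 0 has none: it satisfies every [ord_ge] and no
    [has_ord]. *)
Definition ord_ge x k := forall n, n < k -> x n = 0.

Definition has_ord x k := x k != 0 /\ ord_ge x k.

Lemma ord_geW {x k} l : ord_ge x k -> l <= k -> ord_ge x l.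
Proof. by move=> xk lk n nl; apply: xk; apply: lt_le_trans nl lk. Qed.

Lemma ord_geD x y k : ord_ge x k -> ord_ge y k -> ord_ge (x + y) k.
Proof. by move=> xk yk n nk; rewrite -[LHS]/(x n + y n) xk// yk// addr0. Qed.

Lemma ord_geN x k : ord_ge x k -> ord_ge (- x) k.
Proof. by move=> xk n nk; rewrite -[LHS]/(- x n) xk// oppr0. Qed.

Lemma ord_geB x y k : ord_ge x k -> ord_ge y k -> ord_ge (x - y) k.
Proof. by move=> xk yk; apply: ord_geD => //; apply: ord_geN. Qed.

Lemma ord_geM x y k l : ord_ge x k -> ord_ge y l -> ord_ge (x * y) (k + l).
Proof.
move=> xk yl n nkl; rewrite -[LHS]/(lmul x y n) /=.
apply: fsbig1 => i _; case: (ltP i k) => [/xk->|ki]; first by rewrite mul0r.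
by rewrite yl ?mulr0//; lia.
Qed.

Lemma has_ordM x y k l : has_ord x k -> has_ord y l -> has_ord (x * y) (k + l).
Proof.
move=> [xk0 xk] [yl0 yl]; split; last exact: ord_geM.
rewrite -[(x * y) _]/(lmul x y (k + l)) /= (fsbigE [:: k]) //=; last first.
  move=> i _; rewrite inE => ik; case: (ltP i k) => [/xk->|ki].
    by rewrite mul0r.
  by rewrite yl ?mulr0//; lia.
rewrite big_cons big_nil in_setT addr0.
have -> : k + l - k = l by lia.
exact: mulf_neq0.
Qed.

Lemma has_ordN x k : has_ord x k -> has_ord (- x) k.
Proof.
by move=> [xk0 xk]; split; [rewrite -[(- x) k]/(- x k) oppr_eq0|apply: ord_geN].
Qed.

Lemma has_ordD x y k : has_ord x k -> ord_ge y (k + 1) -> has_ord (x + y) k.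
Proof.
move=> [xk0 xk] yk; split.
  by rewrite -[(x + y) k]/(x k + y k) (yk k) ?addr0//; lia.
by apply: ord_geD => //; apply: ord_geW yk _; lia.
Qed.

Lemma has_ord_ge x k l : has_ord x k -> ord_ge x l -> l <= k.
Proof. by move=> [xk0 _] xl; rewrite leNgt; apply: contraNN xk0 => /xl ->. Qed.

Lemma has_ord_inj x k l : has_ord x k -> has_ord x l -> k = l.
Proof.
move=> xk xl; apply/eqP; rewrite eq_le.
by rewrite (has_ord_ge xl xk.2) (has_ord_ge xk xl.2).
Qed.

Lemma has_ord_neq0 x k : has_ord x k -> x != 0.
Proof. by move=> [xk0 _]; apply: contra_neq xk0 => ->. Qed.

Lemma has_ord1 : has_ord 1 0.
Proof. by split => [|n]; rewrite ?oner_eq0//= => n0; rewrite ifN// lt_eqF. Qed.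

Lemma has_ord_lord x k : has_ord x k -> lord x = k.
Proof.
move=> xk; rewrite /lord; case: xgetP => [l _ xl|/(_ k)]; last by case.
exact: has_ord_inj xl xk.
Qed.

Lemma has_ordV x k : has_ord x k -> has_ord x^-1 (- k).
Proof.
move=> xk; have x0 := has_ord_neq0 xk.
have /lord_ex[l xl] : x^-1 != 0 by rewrite invr_eq0.
have := has_ordM xk xl; rewrite divff// => /(has_ord_inj has_ord1) kl.
by have -> : - k = l by lia.
Qed.

Lemma ord_ge_poly p (n : nat) :
  (pdeg p <= n)%N -> ord_ge (poly_laurent p) (- n%:Z).
Proof.
move=> pn m mn /=; case: ifP => // m0; rewrite nth_default//.
by rewrite (leq_trans (leqSpred _))// (@leq_ltn_trans n)//; lia.
Qed.

Lemma has_ord_poly p : p != 0 -> has_ord (poly_laurent p) (- (pdeg p)%:Z).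
Proof.
move=> p0; split; last exact: ord_ge_poly.
rewrite /= ifT; last by lia.
by rewrite abszN absz_nat -lead_coefE lead_coef_eq0.
Qed.

(** A nonzero polynomial has order at most 0; this integrality is what turns smallness into
    vanishing below. *)
Lemma poly_ord_ge1 p : ord_ge (poly_laurent p) 1 -> p = 0.
Proof.
move=> p1; apply/eqP; apply: contraT => /has_ord_poly pp.
have := has_ord_ge pp p1; lia.
Qed.

Definition quad (u v w x : laurent F) := u * x ^+ 2 + v * x + w.

End LaurentOrder.

(** * Absolute values in terms of orders *)

Section AbsoluteValue.
Local Set Implicit Arguments.
Local Unset Strict Implicit.

Lemma labs_ord (R : realType) (K : finFieldType) (x : laurent K) k :
  has_ord x k -> labs R x = #|K|%:R ^ (- k).
Proof.
move=> xk; rewrite /labs (negbTE (has_ord_neq0 xk)).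
by rewrite (has_ord_lord xk).
Qed.

Lemma card_finField_gt1 (R : realType) (F : finFieldType) : 1 < #|F|%:R :> R.
Proof. by rewrite ltr1n card_finNzRing_gt1. Qed.

Lemma labs_leP (R : realType) (F : finFieldType) (x : laurent F) k :
  labs R x <= #|F|%:R ^ (- k) <-> ord_ge x k.
Proof.
have F1 := card_finField_gt1 R F.
have [->|/lord_ex[l xl]] := eqVneq x 0.
  by rewrite /labs eqxx exprz_ge0// ler0n.
rewrite (labs_ord R xl) ler_eXz2l// lerN2; split=> [kl|/(has_ord_ge xl)//].
exact: ord_geW xl.2 kl.
Qed.

End AbsoluteValue.

(** * Convergents *)

Section ContinuedFraction.
Local Set Implicit Arguments.
Local Unset Strict Implicit.
Variables (F : finFieldType) (b : nat -> {poly F}).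
Hypothesis b0 : b 0%N = 0.
Hypothesis b_deg : forall i, (0 < i)%N -> (0 < pdeg (b i))%N.
Let p := cf_num b.
Let q := cf_den b.

Definition cf_deg n := pdeg (cf_den b n).
Let d := cf_deg.

Let qSS n : q n.+2 = b n.+2 * q n.+1 + q n. Proof. by []. Qed.
Let pSS n : p n.+2 = b n.+2 * p n.+1 + p n. Proof. by []. Qed.

Lemma cf_deg0 : d 0%N = 0%N.
Proof. exact: pdeg1. Qed.

(** The two claims need each other: the degree formula makes q_(n+1) nonzero, and then b_(n+2)
    q_(n+1) dominates q_n in the recurrence. *)
Let cf_den_aux n : q n != 0 /\ d n.+1 = (d n + pdeg (b n.+1))%N.
Proof.
elim: n => [|n [qn0 dS]].
  by split; [exact: oner_neq0|rewrite cf_deg0 /d /cf_deg /= mulr1 addr0].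
have := b_deg (isT : 0 < n.+1)%N; have := b_deg (isT : 0 < n.+2)%N => b2 b1.
have qn1 : q n.+1 != 0 by apply: pdeg_gt0_neq0; rewrite -[pdeg _]/(d n.+1); lia.
have bq : pdeg (b n.+2 * q n.+1) = (d n.+1 + pdeg (b n.+2))%N.
  by rewrite addnC; apply: pdegM => //; apply: pdeg_gt0_neq0.
split=> //; rewrite -bq /d /cf_deg -/(q n.+2) qSS pdegD// bq -[pdeg _]/(d n).
lia.
Qed.

Lemma cf_den_neq0 n : q n != 0.
Proof. by case: (cf_den_aux n). Qed.

Lemma cf_degS n : d n.+1 = (d n + pdeg (b n.+1))%N.
Proof. by case: (cf_den_aux n). Qed.

Lemma cf_deg_add n m : (d n + m <= d (n + m))%N.
Proof.
elim: m => [|m IH]; first by rewrite !addn0.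
have := b_deg (isT : 0 < (n + m).+1)%N.
by rewrite !addnS cf_degS; lia.
Qed.

Lemma leq_cf_deg n m : (n <= m)%N -> (d n <= d m)%N.
Proof. by move=> nm; have := cf_deg_add n (m - n); rewrite subnKC//; lia. Qed.

Lemma cf_deg_ge n : (n <= d n)%N.
Proof. by have := cf_deg_add 0 n; rewrite cf_deg0. Qed.

Lemma leq_pdeg_cf_num n : (pdeg (p n) <= d n)%N.
Proof.
suff : (pdeg (p n) <= d n)%N && (pdeg (p n.+1) <= d n.+1)%N by case/andP.
elim: n => [|n /andP[IH1 IH2]].
  by rewrite /p /= b0 mulr0 add0r pdeg1 {1}/pdeg size_poly0.
rewrite IH2 pSS; apply: leq_pdegD.
  by apply: leq_trans (leq_pdegM _ _) _; rewrite cf_degS; lia.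
by rewrite !cf_degS; lia.
Qed.

Lemma cf_det n : p n.+1 * q n - p n * q n.+1 = (-1) ^+ n.
Proof.
elim: n => [|n IH]; first by rewrite /p /q /= b0 mulr0 add0r mul0r subr0 mulr1.
by rewrite exprS -IH qSS pSS; ring.
Qed.

Let c := convergent b.
Let pl := @poly_laurent F.

Let pl_q0 n : pl (q n) != 0.
Proof. exact: has_ord_neq0 (has_ord_poly (cf_den_neq0 n)). Qed.

(** By [cf_det] the difference is (-1)^n / (q_n q_(n+1)). *)
Lemma has_ord_convergentS n : has_ord (c n.+1 - c n) ((d n)%:Z + (d n.+1)%:Z).
Proof.
have -> : c n.+1 - c n = (-1) ^+ n * ((pl (q n))^-1 * (pl (q n.+1))^-1).
  rewrite -[-1](rmorphN1 (@poly_laurent F)) -(rmorphXn (@poly_laurent F)) -cf_det.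
  rewrite rmorphB !rmorphM /= /c /convergent -/(q n) -/(q n.+1) -/(p n) -/(p n.+1).
  by have := pl_q0 n; have := pl_q0 n.+1; rewrite /pl => ? ?; field; apply/andP.
rewrite -[_ + _]add0r; apply: has_ordM.
  elim: (n) => [|k IH]; first exact: has_ord1.
  rewrite exprS -[0]addr0; apply: has_ordM => //; apply: has_ordN; exact: has_ord1.
by apply: has_ordM; rewrite -[X in has_ord _ X]opprK; apply: has_ordV;
  apply: has_ord_poly; apply: cf_den_neq0.
Qed.

Lemma ord_ge_convergentB n m : (n <= m)%N ->
  ord_ge (c m - c n) ((d n)%:Z + (d n.+1)%:Z).
Proof.
move=> /subnKC <-; elim: (m - n)%N => [|k IH]; first by rewrite addn0 subrr.
rewrite addnS -(subrKC (c (n + k)) (c _.+1)) -addrA addrCA.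
apply: ord_geD => //.
apply: ord_geW (has_ord_convergentS _).2 _.
have : (d n <= d (n + k))%N by apply: leq_cf_deg; lia.
have : (d n.+1 <= d (n + k).+1)%N by apply: leq_cf_deg; lia.
lia.
Qed.

(** Coefficient k has stabilised at index n = |k| + 1, since d_n + d_(n+1) >= 2n + 1 > k. *)
Let lim_coef (k : int) : F := c `|k|.+1 k.

Let lim_coefE n k : k < (d n)%:Z + (d n.+1)%:Z -> lim_coef k = c n k.
Proof.
have cB i j : (i <= j)%N -> k < (d i)%:Z + (d i.+1)%:Z -> c j k = c i k.
  move=> ij kd; have : c j k - c i k = 0 := ord_ge_convergentB ij kd.
  by move=> /eqP; rewrite subr_eq0 => /eqP.
move=> kn; have [nk|kn'] := leqP n `|k|.+1; first exact: cB.
by symmetry; apply: cB; [lia|have := cf_deg_ge `|k|.+1; lia].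
Qed.

Let lim_coefP : exists N : int, forall k, k < N -> lim_coef k = 0.
Proof.
have [N cN] := lcoefP (c 0); exists (Order.min N 0) => k; rewrite lt_min.
by move=> /andP[/cN <- k0]; apply: lim_coefE; lia.
Qed.

Lemma convergents_limit :
  exists x, forall n, ord_ge (c n - x) ((d n)%:Z + (d n.+1)%:Z).
Proof.
exists (Laurent lim_coefP) => n k kn.
by rewrite -[LHS]/(c n k - lim_coef k) (lim_coefE kn) subrr.
Qed.

Variable R : realType.

Let labs_cvgP (u : nat -> laurent F) :
  (labs R (u n) @[n --> \oo] --> (0 : R)) <->
  forall k : nat, \forall n \near \oo, ord_ge (u n) k%:Z.
Proof.
have F1 := card_finField_gt1 R F.
have Fk (k : nat) : #|F|%:R ^ (- k%:Z) = #|F|%:R^-1 ^+ k :> R.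
  by rewrite -exprz_inv -exprnP.
split=> [/cvgr0Pnorm_le u0 k|uk].
  have /u0 : 0 < #|F|%:R ^ (- k%:Z) :> R by rewrite exprz_gt0// (lt_trans ltr01).
  apply: filterS => n un; apply/(labs_leP R); apply: le_trans un.
  exact: ler_norm.
apply/cvgr0Pnorm_le => e e0.
have [k ke] : exists k : nat, #|F|%:R^-1 ^+ k <= e.
  have /cvgr0Pnorm_le/(_ _ e0)[k _ /(_ k (leqnn k)) /= ke] :
      (#|F|%:R^-1 : R) ^+ n @[n --> \oo] --> 0.
    apply: cvg_expr; rewrite ger0_norm ?invr_ge0 ?ler0n//.
    by rewrite invf_lt1// (lt_trans ltr01).
  by exists k; apply: le_trans ke; apply: ler_norm.
have := uk k; apply: filterS => n /(labs_leP R) un.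
rewrite ger0_norm; first by apply: le_trans un _; rewrite Fk.
by rewrite /labs; case: ifP => // _; rewrite exprz_ge0// ler0n.
Qed.

Lemma ord_ge_cf_value n :
  ord_ge (c n - cf_value R b) ((d n)%:Z + (d n.+1)%:Z).
Proof.
have : labs R (convergent b n - cf_value R b) @[n --> \oo] --> (0 : R).
  rewrite /cf_value; have [x cx] := convergents_limit.
  apply: (@xgetPex _ 0 [set x | labs R (convergent b n - x) @[n --> \oo] --> (0 : R)]).
  exists x => /=; apply/labs_cvgP => k; exists k => // m /= km.
  by apply: ord_geW (cx m) _; have := cf_deg_ge m; lia.
move=> /labs_cvgP /(_ (d n + d n.+1)%N)[m _ /= cm].
(* [cf_value] is known only as some limit, so the rate is obtained through a convergent far enough
   out to be close to both terms. *)
set m' := maxn n m; rewrite -(subrK (c m') (c n)) -addrA; apply: ord_geD.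
  by rewrite -opprB; apply/ord_geN/ord_ge_convergentB; rewrite leq_maxl.
by have := cm m' (leq_maxr _ _); rewrite PoszD.
Qed.

Definition cf_err n := poly_laurent (cf_den b n) * cf_value R b
  - poly_laurent (cf_num b n).

(** The order is exact because xi - c_n is dominated by c_(n+1) - c_n: the remainder xi - c_(n+1)
    has order at least d_(n+1) + d_(n+2). *)
Lemma has_ord_cf_err n : has_ord (cf_err n) (d n.+1)%:Z.
Proof.
have xc : has_ord (c n - cf_value R b) ((d n)%:Z + (d n.+1)%:Z).
  rewrite -[c n](subKr (c n.+1)) addrAC addrC; apply: has_ordD.
    exact/has_ordN/has_ord_convergentS.
  apply: (ord_geW (ord_ge_cf_value (n := n.+1))).
  by have := cf_deg_add n 1; have := cf_deg_add n.+1 1; rewrite !addn1; lia.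
have -> : cf_err n = - (pl (q n) * (c n - cf_value R b)).
  by rewrite /cf_err /c /convergent -/(q n) mulrBr mulrCA divff ?mulr1 ?opprB.
have -> : (d n.+1)%:Z = - (d n)%:Z + ((d n)%:Z + (d n.+1)%:Z) by lia.
by apply/has_ordN/has_ordM => //; apply/has_ord_poly/cf_den_neq0.
Qed.

Lemma cf_errSS n : cf_err n.+2 = poly_laurent (b n.+2) * cf_err n.+1 + cf_err n.
Proof.
rewrite /cf_err -/(q n.+2) -/(p n.+2) qSS pSS !rmorphD !rmorphM /=; ring.
Qed.

End ContinuedFraction.

(** * Quadratic forms at xi *)

Section QuadraticApproximation.
Variables (R : realType) (F : finFieldType) (b : nat -> {poly F}) (lam : nat).
Hypothesis b0 : b 0%N = 0.
Hypothesis b_deg : forall i, (0 < i)%N -> (0 < pdeg (b i))%N.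
Hypothesis b_lam : forall i, (0 < i)%N -> (pdeg (b i) <= lam)%N.
Let p := cf_num b.
Let q := cf_den b.
Let d := cf_deg b.
Let xi := cf_value R b.
Let pl := @poly_laurent F.
Let th := cf_err b R.

(** Take the least n with deg x < d_(n+1), so that d_(n+1) <= deg x + lam. If the form were that
    small, the polynomials x p_k + y q_k = q_k (x xi + y) - x th_k would have order at least 1,
    hence vanish, for k = n and n + 1; the determinant of the convergents being a unit, x would be
    0. *)
Lemma linear_form_order (x y : {poly F}) :
  x != 0 -> ~ ord_ge (pl x * xi + pl y) ((pdeg x + lam).+1)%:Z.
Proof.
move=> x0 xy.
have ex : exists n, (pdeg x < d n.+1)%N.
  by exists (pdeg x); have := cf_deg_ge b_deg (pdeg x).+1.
case: (ex_minnP ex) => n xn nmin.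
have dn : (d n <= pdeg x)%N.
  case: n xn nmin => [|n] xn nmin; first by rewrite /d cf_deg0.
  by rewrite leqNgt; apply/negP => /nmin; rewrite ltnn.
have dnS : (d n.+1 <= pdeg x + lam)%N.
  by rewrite /d cf_degS//; apply: leq_add => //; apply: b_lam.
have dnSS : (d n.+1 < d n.+2)%N.
  by rewrite /d [X in (_ < X)%N]cf_degS//; have := b_deg n.+2 isT; lia.
have zero k : (d k <= d n.+1)%N -> (d n.+1 <= d k.+1)%N -> x * p k + y * q k = 0.
  move=> kn nk; apply: poly_ord_ge1.
  have -> : poly_laurent (x * p k + y * q k) =
      pl (q k) * (pl x * xi + pl y) - pl x * th k.
    by rewrite /th /cf_err rmorphD !rmorphM /= -/xi -/(p k) -/(q k) -/pl; ring.
  apply: ord_geB.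
    have -> : 1 = - (d k)%:Z + (d k).+1%:Z by lia.
    apply: ord_geM; first by apply: ord_ge_poly; rewrite /d.
    by apply: ord_geW xy _; lia.
  apply: ord_geW (ord_geM (ord_ge_poly (leqnn _))
    (has_ord_cf_err b0 b_deg R k).2) _.
  by rewrite -/d; lia.
have zn : x * p n + y * q n = 0.
  by apply: zero; [apply: (leq_cf_deg b_deg)|].
have znS : x * p n.+1 + y * q n.+1 = 0 by apply: zero => //; apply: ltnW.
have : x * (-1) ^+ n = 0.
  rewrite -(cf_det b0 n) -/p -/q.
  have -> : x * (p n.+1 * q n - p n * q n.+1) =
    (x * p n.+1 + y * q n.+1) * q n - (x * p n + y * q n) * q n.+1 by ring.
  by rewrite zn znS !mul0r subr0.
by move=> /eqP; rewrite mulf_eq0 (negbTE x0) signr_eq0.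
Qed.

(* If the order k1 were larger, the linear form left after eliminating the    *)
(* square of xi would contradict [linear_form_order].                         *)
Lemma quad_order (a1 b1 c1 a2 b2 c2 : {poly F}) (h1 h2 : nat) (k1 k2 : int) :
  (pdeg a1 <= h1)%N -> (pdeg b1 <= h1)%N -> (pdeg c1 <= h1)%N ->
  (pdeg a2 <= h2)%N -> (pdeg b2 <= h2)%N -> (pdeg c2 <= h2)%N ->
  has_ord (quad (pl a1) (pl b1) (pl c1) xi) k1 ->
  has_ord (quad (pl a2) (pl b2) (pl c2) xi) k2 ->
  (lam + h1.*2 + h2)%N%:Z < k2 -> k1 <= k2 + h2%:Z.
Proof.
move=> da1 db1 dc1 da2 db2 dc2 k1P k2P k2l.
have lin x y (k : nat) : (pdeg x <= k)%N ->
    ord_ge (pl x * xi + pl y) (k + lam)%N.+1%:Z ->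
    x = 0 /\ y = 0.
  move=> xk xy; have [x0|x0] := eqVneq x 0; last first.
    by case: (@linear_form_order x y) => //; apply: ord_geW xy _; lia.
  split=> //; apply: poly_ord_ge1; apply: ord_geW (_ : ord_ge _ (k + lam)%N.+1%:Z) _.
    by move: xy; rewrite x0 /pl rmorph0 mul0r add0r.
  by lia.
(* If a2 = 0, the second form is itself linear in xi and too small, hence zero. *)
have [a20|a20] := eqVneq a2 0.
  have [] := lin b2 c2 h2 db2.
    have := k2P.2; rewrite /quad a20 /pl rmorph0 mul0r add0r => /ord_geW; apply.
    by lia.
  move=> b20 c20; have := has_ord_neq0 k2P.
  by rewrite /quad a20 b20 c20 /pl !rmorph0 !mul0r !addr0 eqxx.
rewrite leNgt; apply/negP => k12.
pose x := a2 * b1 - a1 * b2; pose y := a2 * c1 - a1 * c2.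
have xyE : pl x * xi + pl y =
    pl a2 * quad (pl a1) (pl b1) (pl c1) xi - pl a1 * quad (pl a2) (pl b2) (pl c2) xi.
  by rewrite /quad /pl !rmorphB !rmorphM /=; ring.
have [] := lin x y (h1 + h2)%N.
- apply: leq_pdegD; last rewrite pdegN; apply: leq_trans (leq_pdegM _ _) _; lia.
- rewrite xyE; apply: ord_geB.
    apply: ord_geW (ord_geM (ord_ge_poly da2) k1P.2) _; lia.
  apply: ord_geW (ord_geM (ord_ge_poly da1) k2P.2) _; lia.
(* The eliminated form vanishes, so a2 times the first value equals a1 times the second; comparing
   orders gives k1 = k2 + deg a2 - deg a1, within the bound. *)
move=> x0 y0; move/eqP: xyE; rewrite x0 y0 /pl !rmorph0 mul0r addr0 eq_sym subr_eq0.
move=> /eqP e; have := has_ordM (has_ord_poly a20) k1P; rewrite -/pl e => e1.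
have a10 : a1 != 0.
  by apply: contraTneq (has_ord_neq0 e1) => ->; rewrite /pl rmorph0 mul0r eqxx.
have := has_ord_inj e1 (has_ordM (has_ord_poly a10) k2P); lia.
Qed.

(** The complete quotient after t + 1 letters is - th_t / th_(t+1), so D vanishes exactly when those
    after t + 1 and t + s + 1 letters agree, that is, at eventually periodic expansions. *)
Let D t s := th t * th (t + s).+1 - th t.+1 * th (t + s).

(* Consecutive determinants differ by a sign as long as the letters agree. *)
Let D_S t s : D t s = - D t.+1 s - pl (b t.+2 - b (t + s).+2) * th t.+1 * th (t + s).+1.
Proof.
rewrite /D /th !addSn (cf_errSS b R t) (cf_errSS b R (t + s)) /pl rmorphB /=.
ring.
Qed.

Let D_match t s m k : (forall i, (i < m)%N -> b (t + i).+2 = b (t + s + i).+2) ->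
  has_ord (D (t + m) s) k -> has_ord (D t s) k.
Proof.
elim: m t => [|m IH] t bt; first by rewrite addn0.
rewrite addnS -addSn => /IH kP; rewrite D_S.
have -> : b t.+2 = b (t + s).+2 by have := bt 0%N isT; rewrite !addn0.
rewrite subrr /pl rmorph0 !mul0r subr0; apply/has_ordN/kP => i im.
by have := bt i.+1 im; rewrite !addnS !addSn.
Qed.

(** At the first differing letters the correction term of [D_S] dominates: both products in D (t+1)
    s have order greater than d_(t+2) + d_(t+s+2). *)
Let D_mismatch t s : b t.+2 != b (t + s).+2 ->
  has_ord (D t s)
    ((d t.+2)%:Z + (d (t + s).+2)%:Z - (pdeg (b t.+2 - b (t + s).+2))%:Z).
Proof.
rewrite -subr_eq0 => bD; rewrite D_S addrC; apply: has_ordD.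
  have thP := has_ord_cf_err b0 b_deg R; apply: has_ordN.
  have := has_ordM (has_ordM (has_ord_poly bD) (thP t.+1)) (thP (t + s).+1).
  by rewrite -addrA addrC.
have thP n := (has_ord_cf_err b0 b_deg R n).2.
have dS n : (d n < d n.+1)%N.
  by rewrite /d [X in (_ < X)%N]cf_degS//; have := b_deg (n.+1) isT; lia.
have := dS t.+2; have := dS (t + s).+2 => d1 d2.
apply: ord_geN; rewrite /D addSn; apply: ord_geB.
  by apply: ord_geW (ord_geM (thP _) (thP _)) _; rewrite -/d; lia.
by apply: ord_geW (ord_geM (thP _) (thP _)) _; rewrite -/d; lia.
Qed.

Let quad_D t s : D t s = quad
  (pl (q t * q (t + s).+1 - q t.+1 * q (t + s)))
  (pl (q t.+1 * p (t + s) + p t.+1 * q (t + s) -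
       (q t * p (t + s).+1 + p t * q (t + s).+1)))
  (pl (p t * p (t + s).+1 - p t.+1 * p (t + s))) xi.
Proof.
rewrite /D /quad /th /cf_err -/xi /pl !(rmorphB, rmorphD, rmorphM) /=.
rewrite -/(p _) -/(q _); ring.
Qed.

(** Here [quad_order] is applied with the quadratic polynomial of D t s, whose coefficients have
    degree at most h2 and whose value has order l. The degree of the letter difference lost in l is
    at most the growth of d over that letter, whence the index m + 1 in the size condition and m + 2
    in the conclusion. *)
Lemma quad_order_repetition (u v w : {poly F}) (h t s m : nat) (k : int) :
  (pdeg u <= h)%N -> (pdeg v <= h)%N -> (pdeg w <= h)%N ->
  has_ord (quad (pl u) (pl v) (pl w) xi) k ->
  (forall i, (i < m)%N -> b (t + i).+2 = b (t + s + i).+2) ->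
  b (t + m).+2 != b (t + s + m).+2 ->
  (lam + h.*2 + (d t.+1 + d (t + s).+1) < d (t + m).+1 + d (t + s + m).+1)%N ->
  k <= (d (t + m).+2 + d (t + s + m).+2 + (d t.+1 + d (t + s).+1))%N%:Z.
Proof.
move=> du dv dw kP bt btm lt; rewrite (addnAC t s m) in btm lt *.
have := D_match _ _ _ _ bt (D_mismatch _ _ btm); rewrite quad_D.
set h2 := (d t.+1 + _)%N in lt *; set l := (X in has_ord _ X) => lP.
have bl : (pdeg (b (t + m).+2 - b (t + m + s).+2)
    <= pdeg (b (t + m).+2) + pdeg (b (t + m + s).+2))%N.
  by apply: leq_pdegD; rewrite ?pdegN ?leq_addr ?leq_addl.
have dS n : (d n.+1 = d n + pdeg (b n.+1))%N by apply: cf_degS.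
have dle n : (d n <= d n.+1)%N by rewrite dS leq_addr.
have pq i j x y : (pdeg x <= d i)%N -> (pdeg y <= d j)%N -> (d i + d j <= h2)%N ->
    (pdeg (x * y) <= h2)%N.
  by move=> xi' yj ij; apply: leq_trans (leq_pdegM _ _) _; lia.
have h21 : (d t + d (t + s).+1 <= h2)%N by rewrite /h2 leq_add2r.
have h22 : (d t.+1 + d (t + s) <= h2)%N by rewrite /h2 leq_add2l.
have pd := leq_pdeg_cf_num b0 b_deg; have qd n : (pdeg (q n) <= d n)%N by [].
have kl : k <= l + h2%:Z.
  apply: (quad_order _ _ _ _ _ _ _ _ _ _ du dv dw _ _ _ kP lP) => //; last first.
  - by rewrite /l; have := dS (t + m).+1; have := dS (t + m + s).+1; lia.
  - by apply: leq_pdegD; rewrite ?pdegN; apply: pq;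
      (exact: pd || exact: h21 || exact: h22).
  - apply: leq_pdegD; rewrite ?pdegN; apply: leq_pdegD; apply: pq;
      (exact: pd || exact: qd || exact: h21 || exact: h22).
  - by apply: leq_pdegD; rewrite ?pdegN; apply: pq;
      (exact: qd || exact: h21 || exact: h22).
by rewrite /l in kl; lia.
Qed.

End QuadraticApproximation.

(** * Words *)

Section Factors.
Variables (T : choiceType) (a : nat -> T).

Lemma size_factor i n : size (factor a i n) = n.
Proof. by rewrite size_map size_iota. Qed.

Lemma factorD i m n : factor a i (m + n) = factor a i m ++ factor a (i + m) n.
Proof. by rewrite /factor iotaD map_cat. Qed.

Lemma take_factor i m n : (m <= n)%N -> take m (factor a i n) = factor a i m.
Proof. by move=> mn; rewrite -(subnKC mn) factorD take_size_cat// size_factor. Qed.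

Lemma eq_factorP i j n :
  factor a i n = factor a j n <-> forall k, (k < n)%N -> a (i + k) = a (j + k).
Proof.
split=> [e k kn|e].
  have := congr1 (fun s => nth (a 0) s k) e.
  by rewrite !(nth_map 0%N) ?size_iota// !nth_iota.
apply: (@eq_from_nth _ (a 0)) => [|k]; rewrite !size_factor// => kn.
by rewrite !(nth_map 0%N) ?size_iota// !nth_iota// e.
Qed.

Lemma periodic_factor i s m k j :
  (forall l, (l < m)%N -> a (i + l) = a (i + s + l)) ->
  (j <= s)%N -> (k * s + j <= s + m)%N ->
  flatten (nseq k (factor a i s)) ++ take j (factor a i s) = factor a i (k * s + j).
Proof.
move=> per js; elim: k => [_|k IH]; first by rewrite take_factor.
rewrite mulSn -addnA leq_add2l => kjm /=; rewrite -catA IH; last by lia.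
rewrite (factorD i s); congr (_ ++ _); apply/eq_factorP => l lkj.
by apply: per; lia.
Qed.

Variable R : realType.

(** With exponent n/s the fractional part times s is the integer n mod s, so the ceiling in [wpow]
    rounds nothing. *)
Lemma wpow_periodic i s m : (0 < s)%N ->
  (forall l, (l < m)%N -> a (i + l) = a (i + s + l)) ->
  wpow (factor a i s) ((s + m)%:R / s%:R : R) = factor a i (s + m).
Proof.
move=> s0 per; set n := (s + m)%N; have s0' : 0 < s%:R :> R by rewrite ltr0n.
have nE : n%:R = (n %/ s)%:R * s%:R + (n %% s)%:R :> R.
  by rewrite -natrM -natrD -divn_eq.
have wE : n%:R / s%:R = (n %/ s)%:R + (n %% s)%:R / s%:R :> R.
  by rewrite nE mulrDl mulfK// gt_eqF.
have fl : Num.floor (n%:R / s%:R : R) = (n %/ s)%N%:Z.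
  apply: floor_def; rewrite wE intrD -pmulrn lerDl ltrD2l divr_ge0//=.
  by rewrite ltr_pdivrMr// mul1r ltr_nat ltn_pmod.
rewrite /wpow size_factor fl wE -pmulrn addrAC subrr add0r divfK ?gt_eqF//.
have -> : Num.ceil ((n %% s)%:R : R) = (n %% s)%N%:Z by rewrite pmulrn intrKceil.
rewrite !absz_nat (periodic_factor _ _ m)// -?divn_eq// ltnW// ltn_pmod//.
Qed.

Lemma star_condition_periodic (rho : R) (r s m : nat -> nat) :
  (forall n, (0 < s n)%N) ->
  (forall n l, (l < m n)%N -> a ((r n).+1 + l) = a ((r n).+1 + s n + l)) ->
  (forall n, (s n + m n < s n.+1 + m n.+1)%N) ->
  (forall n, rho * (r n + s n)%:R <= (r n + s n + m n)%:R) ->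
  star_condition a rho.
Proof.
move=> s0 per inc rhoP.
exists (fun n => factor a 1 (r n)), (fun n => factor a (r n).+1 (s n)),
  (fun n => (s n + m n)%:R / (s n)%:R) => n _.
cbv beta; rewrite (wpow_periodic _ _ _ (s0 n) (per n)).
rewrite (wpow_periodic _ _ _ (s0 n.+1) (per n.+1)) !size_cat !size_factor; split.
- by rewrite divr_ge0.
- by rewrite /is_prefix size_cat !size_factor (factorD 1).
- by rewrite ler_pdivlMr ?ltr0n ?addn_gt0 ?s0 ?orbT// addnA.
- exact: inc.
Qed.

Lemma Dio_gap (delta : R) : (Dio R a < delta%:E)%E ->
  exists N, forall r s m, (0 < s)%N -> (N <= s + m)%N ->
    (forall l, (l < m)%N -> a (r.+1 + l) = a (r.+1 + s + l)) ->
    (r + s + m)%:R <= delta * (r + s)%:R.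
Proof.
move=> Dd; apply: contrapT => /forallNP h.
have {}h N : exists x : nat * nat * nat, [/\ (0 < x.1.2)%N, (N <= x.1.2 + x.2)%N,
    (forall l, (l < x.2)%N -> a (x.1.1.+1 + l) = a (x.1.1.+1 + x.1.2 + l)) &
    delta * (x.1.1 + x.1.2)%:R <= (x.1.1 + x.1.2 + x.2)%:R].
  apply: contrapT => hN; apply: (h N) => r s m s0 Nsm per.
  rewrite leNgt; apply/negP => lt; apply: hN; exists (r, s, m).
  by split=> //; apply: ltW.
have [f fP] := choice h.
(* Each repetition is requested longer than the previous one, giving the strict growth in the star
   condition. *)
pose g := fix g n := if n is k.+1 then f ((g k).1.2 + (g k).2).+1 else f 0%N.
have gP n : exists N, g n = f N by case: n => [|n]; eexists.
have : star_condition a delta.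
  apply: (@star_condition_periodic _ (fun n => (g n).1.1) (fun n => (g n).1.2)
    (fun n => (g n).2)) => n.
  - by have [N ->] := gP n; case: (fP N).
  - by have [N ->] := gP n; case: (fP N).
  - by rewrite /=; case: (fP ((g n).1.2 + (g n).2).+1).
  - by have [N ->] := gP n; case: (fP N).
move=> sc; have : (delta%:E <= Dio R a)%E.
  by apply: ereal_sup_ubound; exists delta.
by rewrite leNgt Dd.
Qed.

Lemma Dio_ge1 : (1 <= Dio R a)%E.
Proof.
rewrite leNgt; apply/negP => D1.
have [delta [delta1 Dd]] : exists delta : R, delta < 1 /\ (Dio R a < delta%:E)%E.
  case: (Dio R a) D1 => [x| |] //; last by exists 0; rewrite ltNyr.
  rewrite lte_fin => x1; exists ((x + 1) / 2); rewrite lte_fin; split; lra.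
(* A prefix V taken once, with U empty, already has ratio 1 > delta. *)
have [N /(_ 0%N N.+1 0%N isT)] := Dio_gap _ Dd.
rewrite addn0 add0n leqnSn => /(_ isT) h.
have : (N.+1%:R : R) <= delta * N.+1%:R by apply: h.
by rewrite ler_pMl ?ltr0n// leNgt delta1.
Qed.

Lemma complexity_repetition n K :
  finite_set [set factor a i n | i in [set i : nat | (1 <= i)%N]] ->
  (complexity a n <= K)%N ->
  exists t s, [/\ (0 < s)%N, (t + s <= K)%N &
    forall l, (l < n)%N -> a (t.+2 + l) = a (t.+2 + s + l)].
Proof.
(* Pigeonhole on K + 1 starting positions; they begin at 2 so that th_t and th_(t+1) both precede
   the repeated factor. *)
move=> fin cK; pose w := [seq factor a i.+2 n | i <- iota 0 K.+1].
have : ~~ uniq w.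
  apply/negP => uw; suff : (K.+1 <= complexity a n)%N by lia.
  have <- : #|` [fset x in w]%fset| = K.+1.
    by rewrite card_fseq undup_id// size_map size_iota.
  apply: fsubset_leq_card; apply/fsubsetP => x.
  rewrite [in X in X -> _]in_fset => /mapP[i _ ->].
  by rewrite in_fset_set//; apply/mem_set; exists i.+2.
move=> /(uniqPn [::])[i [j [ij]]]; rewrite size_map size_iota ltnS => jK.
have nthw k : (k < K.+1)%N -> nth [::] w k = factor a k.+2 n.
  by move=> kK; rewrite (nth_map 0%N) ?size_iota// nth_iota.
rewrite !nthw; [|exact: jK|by rewrite (leq_trans ij)// ltnW].
move=> /eq_factorP e; exists i, (j - i)%N; split; [lia|lia|] => l /e ->.
by congr a; lia.
Qed.

End Factors.

(** * Finite sets of words and polynomials *)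

Section Finiteness.

Lemma finite_words (T : choiceType) (A : set T) n : finite_set A ->
  finite_set [set s : seq T | size s = n /\ forall x, x \in s -> A x].
Proof.
move=> finA; elim: n => [|n IH].
  apply: sub_finite_set (finite_set1 [::]) => s /= [/size0nil ->//].
apply: sub_finite_set (finite_image2 (fun x s => x :: s) finA IH).
case=> [|x s] /= [] // [sn] sA; exists x => /=; first by apply: sA; rewrite mem_head.
by exists s => //; split=> // y ys; apply: sA; rewrite inE ys orbT.
Qed.

(** Used over F to bound F[T] in degree, then over F[T] for polynomials in X of bounded height. *)
Lemma finite_poly (R : nzRingType) (A : set R) n : finite_set A ->
  finite_set [set p : {poly R} | (size p <= n)%N /\ forall i, A p`_i].
Proof.
move=> finA; have := finite_image (@Poly R) (finite_words _ _ n finA).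
apply: sub_finite_set.
move=> p /= [pn pA]; exists (mkseq (fun i => p`_i) n).
  by rewrite size_mkseq; split=> // x /mapP[i _ ->].
apply/polyP => i; rewrite coef_Poly.
have [iN|ni] := ltnP i n; first by rewrite nth_mkseq.
by rewrite !nth_default// ?size_mkseq// (leq_trans pn).
Qed.

Lemma finite_poly_deg (F : finFieldType) n :
  finite_set [set p : {poly F} | (pdeg p <= n)%N].
Proof.
have finT : finite_set [set: F] by exact: finite_finset.
apply: sub_finite_set (finite_poly _ _ n.+1 finT) => p /= pn; split=> //.
by rewrite (leq_trans (leqSpred _)).
Qed.

End Finiteness.

(** * The exponent *)

Section ExponentBound.
Variables (R : realType) (F : finFieldType) (b : nat -> {poly F}) (lam : nat).
Hypothesis b0 : b 0%N = 0.
Hypothesis b_deg : forall i, (0 < i)%N -> (0 < pdeg (b i))%N.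
Hypothesis b_lam : forall i, (0 < i)%N -> (pdeg (b i) <= lam)%N.
Let d := cf_deg b.
Let xi := cf_value R b.
Let pl := @poly_laurent F.

Variables (kappa n0 N : nat) (delta c1 c2 : R).
Hypothesis kappa2 : (2 <= kappa)%N.
Hypothesis delta1 : 1 <= delta.
Hypothesis repet : forall n, (n0 <= n)%N ->
  exists t s, [/\ (0 < s)%N, (t + s <= kappa * n)%N &
    forall l, (l < n)%N -> b (t.+2 + l)%N = b (t.+2 + s + l)%N].
Hypothesis gap : forall r s m, (0 < s)%N -> (N <= s + m)%N ->
    (forall l, (l < m)%N -> b (r.+1 + l)%N = b (r.+1 + s + l)%N) ->
    (r + s + m)%:R <= delta * (r + s)%:R.
Hypothesis c1_gt0 : 0 < c1.
Hypothesis c2_gt0 : 0 < c2.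
(** Only starting positions r = O(n) are required: an error term small relative to r + n then stays
    small relative to n, so mere convergence of d_n / n suffices. *)
Hypothesis deg_lower : forall n r, (n0 <= n)%N -> (r <= kappa * n + 1)%N ->
  (d r)%:R + c1 * n%:R <= (d (r + n))%:R.
Hypothesis deg_upper : forall n, (n0 <= n)%N -> (d n)%:R <= c2 * n%:R.

(** The repetition given by low complexity is extended as far as it goes; [gap] caps its length, so
    a first mismatch exists. *)
Lemma maximal_repetition n : (n0 <= n)%N -> (N <= n)%N ->
  exists t s m, [/\ (0 < s)%N, (t + s <= kappa * n)%N, (n <= m)%N,
    (forall i, (i < m)%N -> b (t + i).+2 = b (t + s + i).+2) &
    b (t + m).+2 != b (t + s + m).+2] /\
    (t.+1 + s + m)%:R <= delta * (t.+1 + s)%:R.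
Proof.
move=> n0n Nn; have [t [s [s0 ts per]]] := repet n n0n.
pose P m := all (fun i => b (t + i).+2 == b (t + s + i).+2) (iota 0 m).
have PP m : reflect (forall i, (i < m)%N -> b (t + i).+2 = b (t + s + i).+2) (P m).
  apply: (iffP allP) => h i.
    by move=> im; apply/eqP/h; rewrite mem_iota.
  by rewrite mem_iota => im; apply/eqP/h.
have Pgap m : P m -> (N <= s + m)%N -> (t.+1 + s + m)%:R <= delta * (t.+1 + s)%:R.
  by move=> /PP Pm Nsm; apply: gap => // l; apply: Pm.
have ex : exists m, P m by exists n; apply/PP => i; apply: per.
pose M := (N + Num.bound (delta * (t.+1 + s)%:R))%N.
have ub m : P m -> (m <= M)%N.
  move=> Pm; have [mN|Nm] := leqP m N; first by rewrite (leq_trans mN)// leq_addr.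
  have {}Pm := Pgap m Pm (leq_trans (ltnW Nm) (leq_addl _ _)).
  have := archi_boundP (le_trans (ler0n _ _) Pm).
  move=> /(le_lt_trans Pm); rewrite ltr_nat /M; lia.
case: (ex_maxnP ex ub) => m Pm maxm.
have nm : (n <= m)%N by apply: maxm; apply/PP => i; apply: per.
exists t, s, m; split; last by apply: Pgap => //; lia.
split=> //; first exact/PP.
apply/eqP => bm; have : P m.+1.
  by rewrite /P -addn1 iotaD all_cat -/(P m) Pm /= add0n bm eqxx.
by move=> /maxm; rewrite ltnn.
Qed.

Lemma quad_order_le : exists h0, forall h (u v w : {poly F}) (k : int), (h0 <= h)%N ->
  (pdeg u <= h)%N -> (pdeg v <= h)%N -> (pdeg w <= h)%N ->
  has_ord (quad (pl u) (pl v) (pl w) xi) k ->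
  k%:~R <= 24 * (c2 / c1) * kappa%:R * delta * h%:R.
Proof.
pose n1 := (n0 + N + 1)%N.
exists (lam + 1 + Num.bound (c1 * n1%:R))%N => h u v w k hh du dv dw kP.
have [h1 hlam hb] : [/\ (1 <= h)%N, (lam < h)%N & (Num.bound (c1 * n1%:R) <= h)%N].
  by split; lia.
have hc : c1 * n1%:R <= h%:R.
  apply: le_trans (_ : (Num.bound (c1 * n1%:R))%:R <= _); last by rewrite ler_nat.
  by apply/ltW/archi_boundP; rewrite mulr_ge0// ltW.
have hc1 : c1 <= h%:R.
  apply: le_trans hc; apply: ler_peMr; first exact: ltW.
  by rewrite ler1n /n1; lia.
(* The lower bound gives a gain of at least 2 c1 n >= 4h > lam + 2h, as [quad_order_repetition]
   demands; the upper bound keeps the final estimate linear in h. *)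
have [n cn n3] : exists2 n : nat, 2 * h%:R <= c1 * n%:R & c1 * n%:R <= 3 * h%:R.
  have x0 : 0 <= 2 * h%:R / c1 by rewrite divr_ge0 ?mulr_ge0// ltW.
  have /andP[nle nge] := truncn_itv x0.
  exists (Num.truncn (2 * h%:R / c1)).+1.
    by rewrite -ler_pdivrMl// mulrC ltW.
  have : c1 * (Num.truncn (2 * h%:R / c1))%:R <= 2 * h%:R.
    by rewrite mulrC -ler_pdivlMr.
  rewrite -natr1; lra.
have n1n : (n1 <= n)%N.
  rewrite -(ler_nat R) -(ler_pM2l c1_gt0); apply: le_trans hc (le_trans _ cn).
  by rewrite ler_peMl// ler1n.
have {n1n}[n0n Nn n_gt0] : [/\ (n0 <= n)%N, (N <= n)%N & (0 < n)%N].
  by move: n1n; rewrite /n1; clear; split; lia.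
clear hh hb hc n1.
have [t [s [m [[s0 ts nm per mis] tsm]]]] := maximal_repetition n n0n Nn.
have dle := leq_cf_deg b_deg.
have lt : (lam + h.*2 + (d t.+1 + d (t + s).+1) < d (t + m).+1 + d (t + s + m).+1)%N.
  have l1 : (d (t + s).+1)%:R + c1 * n%:R <= (d (t + s + m).+1)%:R.
    apply: le_trans (deg_lower n (t + s).+1 n0n _) _; first by rewrite addn1 ltnS.
    by rewrite ler_nat; apply: dle; rewrite addSn ltnS leq_add2l.
  have l2 : (d t.+1)%:R + c1 * n%:R <= (d (t + m).+1)%:R.
    apply: le_trans (deg_lower n t.+1 n0n _) _.
      by rewrite addn1 ltnS (leq_trans (leq_addr s t)).
    by rewrite ler_nat; apply: dle; rewrite addSn ltnS leq_add2l.
  have lamh : lam%:R < h%:R :> R by rewrite ltr_nat.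
  rewrite -(ltr_nat R) -addnn !natrD; lra.
have := quad_order_repetition R F b lam b0 b_deg b_lam
  u v w h t s m k du dv dw kP per mis lt.
rewrite -/d => kd.
have {}kd : k%:~R <= 4 * (d (t + s + m).+2)%:R :> R.
  have : k <= (4 * d (t + s + m).+2)%N%:Z.
    apply: le_trans kd _; rewrite lez_nat.
    have e1 : (d (t + m).+2 <= d (t + s + m).+2)%N.
      by apply: dle; rewrite !ltnS leq_add2r leq_addr.
    have e2 : (d t.+1 <= d (t + s + m).+2)%N.
      by apply: dle; rewrite ltnS leqW// -addnA leq_addr.
    have e3 : (d (t + s).+1 <= d (t + s + m).+2)%N.
      by apply: dle; rewrite ltnS leqW// leq_addr.
    by clear -e1 e2 e3; lia.
  by rewrite -(ler_int R) -pmulrn natrM.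
apply: le_trans kd _.
have du' : (d (t + s + m).+2)%:R <= c2 * (t + s + m).+2%:R.
  apply: deg_upper; rewrite (leq_trans n0n)// (leq_trans nm)//.
  by rewrite -addn2 addnAC leq_addl.
have k2 : 2 <= kappa%:R :> R by rewrite ler_nat.
(* The factor 2 absorbs the additive constants. With k <= 4 d_(t+s+m+2) this gives 4 * 2 * 3 = 24,
   the 3 coming from c1 n <= 3h. *)
have tsm' : (t + s + m).+2%:R <= 2 * delta * (kappa%:R * n%:R).
  have -> : (t + s + m).+2%:R = (t.+1 + s + m)%:R + 1 :> R by rewrite natr1 !addSn.
  have h1' : delta * (t.+1 + s)%:R <= delta * (kappa%:R * n%:R + 1).
    rewrite ler_wpM2l ?(le_trans ler01)//.
    by rewrite -natrM natr1 ler_nat addSn ltnS.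
  have h2' : 2 <= kappa%:R * n%:R :> R.
    by rewrite -natrM ler_nat (leq_trans kappa2)// leq_pmulr.
  have : 0 <= delta * (kappa%:R * n%:R - 2).
    by apply: mulr_ge0; [apply: le_trans delta1|rewrite subr_ge0].
  move: (le_trans tsm h1') delta1.
  move: (t.+1 + s + m)%:R (kappa%:R * n%:R) => X Y hX hd hY; lra.
apply: le_trans (_ : 4 * (c2 * (2 * delta * (kappa%:R * n%:R))) <= _).
  by rewrite ler_pM2l//; apply: le_trans du' _; rewrite ler_pM2l.
have -> : 4 * (c2 * (2 * delta * (kappa%:R * n%:R))) =
    (8 * (c2 / c1) * kappa%:R * delta) * (c1 * n%:R) by field; rewrite gt_eqF.
have -> : 24 * (c2 / c1) * kappa%:R * delta * h%:R =
    (8 * (c2 / c1) * kappa%:R * delta) * (3 * h%:R) by ring.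
apply: ler_wpM2l => //.
have delta0 : 0 <= delta by apply: le_trans delta1.
by rewrite !mulr_ge0// ?invr_ge0 ltW.
Qed.

End ExponentBound.

(** * From orders of quadratic forms to w_2 *)

Section ApproxExp.
Variables (R : realType) (F : finFieldType) (x : laurent F).

Lemma peval_quad (P : {poly {poly F}}) : (size P <= 3)%N ->
  peval P x = quad (poly_laurent P`_2) (poly_laurent P`_1) (poly_laurent P`_0) x.
Proof.
move=> P3; rewrite /peval (@horner_coef_wide _ 3); last first.
  by rewrite (leq_trans (size_poly _ _)).
rewrite !big_ord_recr big_ord0 /= !coef_map /= /quad; ring.
Qed.

Lemma approx_exp2_le (C : R) (h0 : nat) : 0 <= C ->
  (forall h (u v w : {poly F}) (k : int), (h0 <= h)%N ->
    (pdeg u <= h)%N -> (pdeg v <= h)%N -> (pdeg w <= h)%N ->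
    has_ord (quad (poly_laurent u) (poly_laurent v) (poly_laurent w) x) k ->
    k%:~R <= C * h%:R) ->
  (approx_exp R 2 x <= C%:E)%E.
Proof.
move=> C0 hC; apply: ge_ereal_sup => _ [w /= winf <-]; rewrite lee_fin.
have [w0|w0] := leP w 0; first exact: le_trans C0.
(* Only finitely many P have all coefficients of degree at most h0, so an infinite family contains
   one of large height. *)
have [P [[P3 /andP[Px0 Pw]] [j hj]]] : exists P : {poly {poly F}},
    ((size P <= 3)%N /\ 0 < labs R (peval P x) <= height R P `^ (- w)) /\
    exists j, (h0 < pdeg P`_j)%N.
  apply: contrapT => /forallNP hP; apply: winf.
  apply: sub_finite_set (finite_poly _ _ 3 (finite_poly_deg F h0)) => P /= PP.
  split=> [|i]; first by case: PP.
  by rewrite leqNgt; apply/negP => hi; apply: (hP P); split=> //; exists i.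
pose i0 := [arg max_(i > (ord0 : 'I_3)) pdeg P`_i].
pose h := pdeg P`_i0.
have hmax i : (i < 3)%N -> (pdeg P`_i <= h)%N.
  move=> i3; rewrite /h /i0; by case: arg_maxnP => // j0 _ /(_ (Ordinal i3) isT).
have hh : (h0 < h)%N.
  apply: leq_trans hj _; have [/hmax//|j3] := ltnP j 3.
  by rewrite nth_default ?(leq_trans P3)// /pdeg size_poly0.
have F1 := card_finField_gt1 R F.
have Pi0 : P`_i0 != 0 by apply: pdeg_gt0_neq0; apply: leq_ltn_trans hh.
have hgt : #|F|%:R ^+ h <= height R P.
  have i0P : (i0 < size P)%N.
    by rewrite ltnNge; apply: contra Pi0 => /(nth_default 0) ->.
  apply: le_trans (le_bigmax _ _ (Ordinal i0P)).
  by rewrite /= (labs_ord R (has_ord_poly Pi0)) opprK -exprnP.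
have px0 : peval P x != 0 by apply: contraTneq Px0 => ->; rewrite /labs eqxx ltxx.
have [k kP] := lord_ex px0; rewrite -/(has_ord _ _) in kP.
have kC : k%:~R <= C * h%:R.
  apply: (hC _ P`_2 P`_1 P`_0); rewrite ?hmax//; first exact: ltnW.
  by rewrite -peval_quad.
(* Taking logarithms to base |F| in |P(xi)| <= H(P)^(-w), with H(P) >= |F|^h and w > 0. *)
have wk : w * h%:R <= k%:~R.
  move: Pw; rewrite (labs_ord R kP) => Pw.
  have F0 : 0 < #|F|%:R :> R by apply: lt_trans F1.
  have lnF : 0 < ln #|F|%:R :> R by apply: ln_gt0.
  have H0 : 0 < height R P by apply: lt_le_trans hgt; apply: exprn_gt0.
  have hH : h%:R * ln #|F|%:R <= ln (height R P).
    by rewrite mulr_natl -lnXn// ler_ln ?posrE ?exprn_gt0.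
  rewrite -(powR_intmul _ (ltW F0)) in Pw.
  have : - k%:~R * ln #|F|%:R <= - w * ln (height R P).
    by rewrite -mulrNz -!ln_powR ler_ln ?posrE ?powR_gt0.
  rewrite !mulNr lerN2 => /(le_trans (ler_wpM2l (ltW w0) hH)).
  by rewrite mulrA ler_pM2r.
have h_gt0 : 0 < h%:R :> R by rewrite ltr0n (leq_ltn_trans _ hh).
by rewrite -(ler_pM2r h_gt0); apply: le_trans wk kC.
Qed.

End ApproxExp.

(** * Linear growth of the degrees d_n *)

Section DegreeGrowth.
Variables (R : realType) (F : finFieldType) (b : nat -> {poly F}).
Hypothesis b_deg : forall i, (0 < i)%N -> (0 < pdeg (b i))%N.
Let d := cf_deg b.
Let Q : R := #|F|%:R.

Let Q1 : 1 < Q. Proof. exact: card_finField_gt1. Qed.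

Lemma cf_deg_le_linear (L : R) n :
  (forall i, (0 < i)%N -> (pdeg (b i))%:R <= L) -> (d n)%:R <= L * n%:R.
Proof.
move=> bL; elim: n => [|n IH]; first by rewrite /d cf_deg0 mulr0.
by rewrite /d cf_degS// natrD -natr1 mulrDr mulr1 lerD// bL.
Qed.

Lemma cf_deg_cvg :
  cvgn (fun n : nat => labs R (poly_laurent (cf_den b n)) `^ n%:R^-1) ->
  exists2 l : R, 1 <= l & forall e, 0 < e ->
    exists n1, forall n, (n1 <= n)%N -> `|(d n)%:R - l * n%:R| <= e * n%:R.
Proof.
have Q0 : 0 < Q by apply: lt_trans Q1.
have lnQ : 0 < ln Q by apply: ln_gt0.
set u := (fun n : nat => _) => /cvg_ex[g ug].
have lnu n : (0 < n)%N -> ln (u n) = ((d n)%:R / n%:R) * ln Q.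
  move=> n0; rewrite /u ln_powR (labs_ord R (has_ord_poly (cf_den_neq0 b_deg n))).
  by rewrite opprK -exprnP lnXn// -[_ *+ pdeg _]mulr_natl mulrA [_^-1 * _]mulrC.
have uQ n : (0 < n)%N -> Q <= u n.
  move=> n0; rewrite -ler_ln ?posrE//; last first.
    rewrite /u powR_gt0// (labs_ord R (has_ord_poly (cf_den_neq0 b_deg n))).
    by rewrite exprz_gt0.
  rewrite lnu// ler_peMl ?(ltW lnQ)// ler_pdivlMr ?ltr0n// mul1r ler_nat.
  exact: cf_deg_ge.
(* Since d_n >= n, the limit stays away from 0, where ln is not continuous; it also gives l >= 1. *)
have Qg : Q <= g.
  by apply: (cvgr_to_ge ug); exists 1%N => // n /= n0; apply: uQ.
have g0 : 0 < g by apply: lt_le_trans Qg.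
have lnug : ln (u n) @[n --> \oo] --> ln g.
  exact: (cvg_comp _ _ ug (continuous_ln g0)).
exists (ln g / ln Q) => [|e e0].
  by rewrite ler_pdivlMr// mul1r ler_ln// posrE.
have e0' : 0 < e * ln Q by rewrite mulr_gt0.
move/cvgrPdist_le : lnug => /(_ _ e0')[n1 _ h].
exists n1.+1 => n n1n; have n0 : 0 < n%:R :> R by rewrite ltr0n (leq_trans _ n1n).
have := h n (ltnW n1n); rewrite /= lnu; last by rewrite (leq_trans _ n1n).
rewrite distrC.
have -> : (d n)%:R / n%:R * ln Q - ln g =
    ((d n)%:R - ln g / ln Q * n%:R) * (ln Q / n%:R).
  by field; rewrite !gt_eqF.
rewrite normrM [X in _ * X]ger0_norm ?divr_ge0 ?(ltW lnQ)//.
by rewrite mulrA ler_pdivrMr// [leRHS]mulrAC ler_pM2r.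
Qed.

Lemma cf_deg_linear (kappa : nat) (l : R) : 1 <= l ->
  (forall e, 0 < e ->
    exists n1, forall n, (n1 <= n)%N -> `|(d n)%:R - l * n%:R| <= e * n%:R) ->
  exists n1, forall n, (n1 <= n)%N -> (d n)%:R <= 2 * l * n%:R /\
    forall r, (r <= kappa * n + 1)%N -> (d r)%:R + l / 2 * n%:R <= (d (r + n))%:R.
Proof.
move=> l1 dl; have [n1 dl1] := dl 1 ltr01.
pose K : R := (2 * kappa + 1)%:R.
have K1 : 1 <= K by rewrite ler1n addn1.
(* The errors at r and r + n total at most e (2r + n) <= e (K n + 2), so this e costs at most n/8 +
   1/4. Indices r below n2 cost d_(n2), and d_(n2) + 1/4 <= n/4 for large n; the loss stays below l
   n / 2. *)
have [e e0 eK] : exists2 e : R, 0 < e & e * (8 * K) = 1.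
  exists (8 * K)^-1; first by rewrite invr_gt0; lra.
  by rewrite mulVf// gt_eqF//; lra.
have [n2 dl2] := dl e e0.
exists (n1 + n2 + (4 * d n2 + 4))%N => n nn; split=> [|r rn].
  have /dl1 : (n1 <= n)%N by apply: leq_trans nn; rewrite -addnA leq_addr.
  rewrite ler_norml => /andP[_]; rewrite mul1r => h.
  have : n%:R <= l * n%:R by rewrite ler_peMl.
  by move: h; lra.
have n2n : (n2 <= n)%N by apply: leq_trans nn; rewrite addnAC leq_addl.
have h4 : 4 * (d n2)%:R + 4 <= n%:R :> R.
  by rewrite -natrM -natrD ler_nat; apply: leq_trans nn; rewrite leq_addl.
have h1 : - (e * (r%:R + n%:R)) <= (d (r + n))%:R - l * (r%:R + n%:R).
  have /dl2 : (n2 <= r + n)%N by rewrite (leq_trans n2n)// leq_addl.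
  by rewrite ler_norml => /andP[+ _]; rewrite natrD.
have h2 : (d r)%:R <= (l + e) * r%:R + (d n2)%:R.
  have [/dl2|rn2] := leqP n2 r.
    rewrite ler_norml => /andP[_] h.
    have := ler0n R (d n2); move: h; lra.
  have : (d r <= d n2)%N by apply: leq_cf_deg => //; apply: ltnW.
  rewrite -(ler_nat R) => /le_trans; apply.
  by rewrite lerDr mulr_ge0// addr_ge0 ?(ltW e0)// (le_trans _ l1).
have h3 : e * (2 * r%:R + n%:R) <= n%:R / 8 + 1 / 4.
  apply: le_trans (_ : e * (K * n%:R + 2) <= _).
    rewrite ler_pM2l//.
    have : r%:R <= kappa%:R * n%:R + 1 :> R by rewrite -natrM natr1 ler_nat -addn1.
    rewrite /K natrD natrM => hr; lra.
  have -> : e * (K * n%:R + 2) = e * (8 * K) * (n%:R / 8) + 2 * e by field.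
  rewrite eK mul1r lerD2l.
  have : 0 <= e * (K - 1) by rewrite mulr_ge0 ?(ltW e0)// subr_ge0.
  move: eK; lra.
have h5 : n%:R <= l * n%:R by rewrite ler_peMl.
have h6 : 0 <= n%:R :> R by [].
lra.
Qed.

End DegreeGrowth.

(** * The bound in terms of complexity and Dio *)

Section Complexity.
Variables (F : finFieldType) (b : nat -> {poly F}) (lam : nat).
Hypothesis b_lam : forall i, (0 < i)%N -> (pdeg (b i) <= lam)%N.

Lemma finite_factors n :
  finite_set [set factor b i n | i in [set i : nat | (1 <= i)%N]].
Proof.
apply: sub_finite_set (finite_words _ _ n (finite_poly_deg F lam)) => _ /= [i i1 <-].
rewrite size_factor; split=> // p /mapP[j]; rewrite mem_iota => /andP[ij _] ->.
by apply: b_lam; apply: leq_trans ij.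
Qed.

End Complexity.

Lemma approx_exp_complexity (R : realType) (F : finFieldType) (b : nat -> {poly F})
    (lam kappa n0 : nat) (D c1 c2 : R) :
  b 0%N = 0 ->
  (forall i, (0 < i)%N -> (0 < pdeg (b i) <= lam)%N) ->
  (2 <= kappa)%N ->
  (forall n, (n0 <= n)%N -> (complexity b n <= kappa * n)%N) ->
  Dio R b = D%:E ->
  0 < c1 -> 0 < c2 ->
  (forall n, (n0 <= n)%N -> (cf_deg b n)%:R <= c2 * n%:R /\
    forall r, (r <= kappa * n + 1)%N ->
      (cf_deg b r)%:R + c1 * n%:R <= (cf_deg b (r + n))%:R) ->
  (approx_exp R 2 (cf_value R b) <= (48 * (c2 / c1) * kappa%:R * D)%:E)%E.
Proof.
move=> b0 b_lam kappa2 bc DE c1_gt0 c2_gt0 growth.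
have b_deg i : (0 < i)%N -> (0 < pdeg (b i))%N by move=> /b_lam /andP[].
have b_le i : (0 < i)%N -> (pdeg (b i) <= lam)%N by move=> /b_lam /andP[].
have D1 : 1 <= D by rewrite -lee_fin -DE; apply: Dio_ge1.
(* Any delta above D would do; delta = 2D turns 24 into 48 and exceeds D because D >= 1. *)
have [|N gap] := Dio_gap _ b R (2 * D).
  by rewrite DE lte_fin; lra.
have delta1 : 1 <= 2 * D by lra.
have repet n : (n0 <= n)%N -> exists t s, [/\ (0 < s)%N, (t + s <= kappa * n)%N &
    forall l, (l < n)%N -> b (t.+2 + l)%N = b (t.+2 + s + l)%N].
  by move=> /bc; apply: complexity_repetition; apply: finite_factors b_le n.
have lower n r : (n0 <= n)%N -> (r <= kappa * n + 1)%N ->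
    (cf_deg b r)%:R + c1 * n%:R <= (cf_deg b (r + n))%:R.
  by move=> /growth[_]; apply.
have upper n : (n0 <= n)%N -> (cf_deg b n)%:R <= c2 * n%:R.
  by move=> /growth[].
have [h0 h0P] := quad_order_le R F b lam b0 b_deg b_le kappa n0 N (2 * D)
  c1 c2 kappa2 delta1 repet gap c1_gt0 c2_gt0 lower upper.
apply: (approx_exp2_le R F _ _ h0).
  by rewrite !mulr_ge0// ?invr_ge0 ?(ltW c1_gt0) ?(ltW c2_gt0)// (le_trans _ D1).
move=> h u v w k hh du dv dw kP; have := h0P h u v w k hh du dv dw kP.
by move=> /le_trans; apply; rewrite le_eqVlt; apply/orP; left; apply/eqP; ring.
Qed.

(** * Independence from the letter of index 0 *)

Section FirstLetter.
Variables (R : realType) (T : choiceType) (a b : nat -> T).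
Hypothesis ab : forall i, (0 < i)%N -> a i = b i.

Lemma eq_factor i n : (0 < i)%N -> factor a i n = factor b i n.
Proof.
move=> i0; apply/eq_in_map => j; rewrite mem_iota => /andP[ij _].
by apply: ab; apply: leq_trans ij.
Qed.

Lemma eq_Dio : Dio R a = Dio R b.
Proof.
have e : (fun W => is_prefix W a) = (fun W => is_prefix W b).
  by apply/funext => W; rewrite /is_prefix eq_factor.
congr ereal_sup; congr image; apply/seteqP; split=> rho [U [V [w h]]];
  exists U, V, w => n /h[? pre ? ?]; split=> //.
- by rewrite -[is_prefix _ b]/((fun W => is_prefix W b) _) -e.
- by rewrite -[is_prefix _ a]/((fun W => is_prefix W a) _) e.
Qed.

Lemma eq_complexity n : complexity a n = complexity b n.
Proof.
rewrite /complexity; congr (#|` fset_set _|%fset); apply/seteqP.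
by split=> _ [i i1 <-]; exists i => //; rewrite eq_factor.
Qed.

End FirstLetter.

Theorem theorem1p4 (R : realType) (p e q : nat) (F : finFieldType)
    (hp : prime p) (he : (1 <= e)%N) (hq : q = (p ^ e)%N) (hF : #|F| = q)
    (kappa A : nat) (hkappa : (2 <= kappa)%N) (hA : (q <= A)%N)
    (a : nat -> {poly F})
    (ha : forall n, (1 <= n)%N -> q%:R <= labs R (poly_laurent (a n)) <= A%:R)
    (hcomplexity : exists n0 : nat, (1 <= n0)%N /\
       forall n, (n0 <= n)%N -> (complexity a n <= kappa * n)%N)
    (hDio : Dio R a \is a fin_num) :
  let b := fun n : nat => if n == 0%N then 0 else a n in
  let xi := cf_value R b in
  (approx_exp R 2 xi <=
     (128 * (2 * kappa%:R + 1) ^+ 3)%:E * Dio R a * ((ln A%:R / ln q%:R) ^+ 4)%:E)%E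
  /\
  (cvgn (fun n : nat => labs R (poly_laurent (cf_den b n)) `^ (n%:R^-1)) ->
   (approx_exp R 2 xi <= (64 * (2 * kappa%:R + 1) ^+ 3)%:E * Dio R a)%E).
Proof.
move=> b xi.
have ab i : (0 < i)%N -> a i = b i by case: i.
rewrite (eq_Dio R _ a b ab) in hDio *.
have [n0 [_ bc]] := hcomplexity.
have {}bc n : (n0 <= n)%N -> (complexity b n <= kappa * n)%N.
  by move=> /bc; rewrite (eq_complexity _ a b ab).
have q1 : 1 < q%:R :> R by rewrite -hF; apply: card_finField_gt1.
have lnq : 0 < ln (q%:R : R) by apply: ln_gt0.
(* On degrees, the hypothesis reads 1 <= deg a_i and q^(deg a_i) <= A. *)
have bA i : (0 < i)%N -> (1 <= pdeg (b i))%N /\ (q ^ pdeg (b i) <= A)%N.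
  move=> i0; rewrite -ab//; have /andP[] := ha i i0.
  have a0 : a i != 0.
    apply: contraTneq q1 => ai0; have /andP[] := ha i i0.
    by rewrite ai0 rmorph0 /labs eqxx => q0 _; rewrite ltNge (le_trans q0).
  rewrite (labs_ord R (has_ord_poly a0)) opprK -exprnP hF => qle leA; split.
    by rewrite -(ler_eXn2l q1) expr1.
  by rewrite -(ler_nat R) natrX.
(* The crude bound deg < q^deg <= A suffices: lam influences only how large h must be, not the
   constant. *)
have b_lam i : (0 < i)%N -> (0 < pdeg (b i) <= A)%N.
  move=> /bA[-> qA]; apply: leq_trans qA; apply/ltnW/ltn_expl.
  by rewrite -(ltr_nat R).
have b_deg i : (0 < i)%N -> (0 < pdeg (b i))%N by move=> /bA[].
have [D DE] : exists D, Dio R b = D%:E by exists (fine (Dio R b)); rewrite fineK.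
have D1 : 1 <= D by rewrite -lee_fin -DE; apply: Dio_ge1.
have kappa2 : 2 <= kappa%:R :> R by rewrite ler_nat.
have K2 : 4 * kappa%:R <= (2 * kappa%:R + 1) ^+ 3 :> R.
  have : 0 <= (2 * kappa%:R + 1 - 2) * ((2 * kappa%:R + 1) ^+ 2) :> R.
    by rewrite mulr_ge0 ?exprn_ge0//; lra.
  have : 0 <= kappa%:R * kappa%:R :> R by rewrite mulr_ge0.
  rewrite !exprS expr0 mulr1; lra.
have KD : 4 * kappa%:R * D <= (2 * kappa%:R + 1) ^+ 3 * D.
  by rewrite ler_pM2r// (lt_le_trans ltr01).
have KD0 : 0 <= kappa%:R * D by rewrite mulr_ge0// (le_trans ler01).
rewrite DE; split=> [|cv].
  have A1 : 1 < A%:R :> R by apply: lt_le_trans q1 _; rewrite ler_nat.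
  pose L : R := ln A%:R / ln q%:R.
  have bL i : (0 < i)%N -> (pdeg (b i))%:R <= L.
    move=> /bA[_ qA]; rewrite ler_pdivlMr// mulr_natl -lnXn ?(lt_trans ltr01)//.
    by rewrite ler_ln ?posrE ?exprn_gt0 ?(lt_trans ltr01)// -natrX ler_nat.
  have L1 : 1 <= L by apply: le_trans (bL 1%N isT); rewrite ler1n b_deg.
  (* Each letter adds between 1 and L = log A / log q to the degree, so c1 = 1 and c2 = L. *)
  have := approx_exp_complexity R F b A kappa n0 D 1 L erefl b_lam hkappa bc DE ltr01.
  move=> /(_ (lt_le_trans ltr01 L1)) le; apply: le_trans (le _) _.
    move=> n _; split=> [|r _]; first exact: cf_deg_le_linear.
    by rewrite mul1r -natrD ler_nat; apply: cf_deg_add.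
  rewrite -!EFinM lee_fin divr1 -/L.
  have L4 : L <= L ^+ 4 by apply: ler_eXnr.
  have X0 : 0 <= 128 * (2 * kappa%:R + 1) ^+ 3 * D :> R by lra.
  apply: le_trans (_ : 128 * (2 * kappa%:R + 1) ^+ 3 * D * L <= _).
    have : 0 <= ((2 * kappa%:R + 1) ^+ 3 * D - 4 * kappa%:R * D) * L.
      by rewrite mulr_ge0 ?subr_ge0// (le_trans ler01).
    have : 0 <= kappa%:R * D * L by rewrite mulr_ge0// (le_trans ler01).
    lra.
  exact: ler_wpM2l.
have [l l1 dl] := cf_deg_cvg R F b b_deg cv.
have [n1 n1P] := cf_deg_linear R F b b_deg kappa l l1 dl.
(* Here c2/c1 = 2l / (l/2) = 4, and 48 * 4 kappa <= 64 (2 kappa + 1)^3. *)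
have := approx_exp_complexity R F b A kappa (n0 + n1) D (l / 2) (2 * l)
  erefl b_lam hkappa.
move=> /(_ (fun n nn => bc n (leq_trans (leq_addr _ _) nn)) DE).
have l0 : 0 < l by apply: lt_le_trans l1.
have two0 : 0 < 2 :> R by [].
move=> /(_ (divr_gt0 l0 two0) (mulr_gt0 two0 l0)).
move=> /(_ (fun n nn => n1P n (leq_trans (leq_addl _ _) nn))) /le_trans; apply.
rewrite -EFinM lee_fin.
have -> : 2 * l / (l / 2) = 4 by field; rewrite gt_eqF.
lra.
Qed.
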